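(* Let $T\in\mathbb{N}$, let $(\Omega,\mathcal{F},\mathbb{P})$ be a probability space with filtration $\mathcal{F}_0\subset\mathcal{F}_1\subset\cdots\subset\mathcal{F}_T=\mathcal{F}$, and for each $t=0,\dots,T$ let $(X_t,d_{X_t})$ and $(Z_t,d_{Z_t})$ be $\mathcal{F}_t$-conditional metric spaces. For each $t=0,\dots,T-1$ let $\Theta_t$ assign to each $x\in X_t$ a subset $\Theta_t(x)$ of $Z_t$ such that: (c1) $\emptyset\neq\Theta_t(x)\subset Z_t$ for all $x\in X_t$; (c2) $\Theta_t\big(\sum_k 1_{A_k}x_k\big)=\sum_k 1_{A_k}\Theta_t(x_k):=\big\{\sum_k 1_{A_k}z_k: z_k\in\Theta_t(x_k)\text{ for all }k\big\}$ for all $(A_k)\in\Pi_{\mathcal{F}_t}$ and every sequence $(x_k)$ in $X_t$; (c3) for every $x\in X_t$ and every sequence $(z_n)$ in $\Theta_t(x)$ there exist $n_1<n_2<\cdots$ with $n_k\in L^0_t(\mathbb{N})$ and $z\in\Theta_t(x)$ such that $z_{n_k}\to z$ a.s.; (c4) for every sequence $(x_n)$ in $X_t$ with $x_n\to x\in X_t$ a.s. and every sequence $(z_n)$ with $z_n\in\Theta_t(x_n)$ for all $n$, there exist $n_1<n_2<\cdots$ with $n_k\in L^0_t(\mathbb{N})$ and a sequence $(z'_k)$ in $\Theta_t(x)$ such that $d_{Z_t}(z_{n_k},z'_k)\to 0$ a.s. For $t=0,\dots,T-1$ let $v_t:X_t\times Z_t\to X_{t+1}$ be (v1) $\mathcal{F}_t$-stable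 and (v2) sequentially continuous, and let $u_t:X_t\times\underline{L}^0_{t+1}\times Z_t\to\underline{L}^0_t$ be (u1) $\mathcal{F}_t$-stable, (u2) increasing in the second component, and (u3) sequentially upper semi-continuous. Let $u_T:X_T\to\underline{L}^0_T$ be $\mathcal{F}_T$-stable and sequentially upper semi-continuous. For $t=0,\dots,T-1$ and $x_t\in X_t$ put $$C_t(x_t):=\Big\{\big((x_s)_{s=t+1}^T,(z_s)_{s=t}^{T-1}\big): x_{s+1}=v_s(x_s,z_s),\ z_s\in\Theta_s(x_s)\text{ for all }s=t,\dots,T-1\Big\}$$ and $$y_t(x_t):=\sup_{((x_s)_{s=t+1}^T,(z_s)_{s=t}^{T-1})\in C_t(x_t)}u_t(x_t,\cdot,z_t)\circ\cdots\circ u_{T-1}(x_{T-1},\cdot,z_{T-1})\circ u_T(x_T),$$ and put $y_T:=u_T$. Then for all $t=0,\dots,T$ the function $y_t$ maps $X_t$ into $\underline{L}^0_t$, is $\mathcal{F}_t$-stable and sequentially upper semi-continuous, and these functions can be computed by the backward recursion $$y_T(x_T)=u_T(x_T),\qquad y_t(x_t)=\max_{z_t\in\Theta_t(x_t)}u_t\big(x_t,y_{t+1}(v_t(x_t,z_t)),z_t\big),\quad t=0,\dots,T-1$$ (in particular, the maxima are attained). Moreover, for every $t\in\{0,\dots,T-1\}$ and $x_t\in X_t$, every process $((x^*_s)_{s=t}^T,(z^*_s)_{s=t}^{T-1})$ given by $x_t^*=x_t$ and the forward recursion $$x^*_{s+1}=v_s(x^*_s,z^*_s),\quad\text{where } z^*_s\in\mathop{\rm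 argmax}_{z_s\in\Theta_s(x^*_s)}u_s\big(x^*_s,y_{s+1}(v_s(x^*_s,z_s)),z_s\big),\qquad s=t,\dots,T-1,$$ satisfies $((x^*_s)_{s=t+1}^T,(z^*_s)_{s=t}^{T-1})\in C_t(x_t)$ and $$y_t(x_t)=u_t(x_t,\cdot,z^*_t)\circ\cdots\circ u_{T-1}(x^*_{T-1},\cdot,z^*_{T-1})\circ u_T(x^*_T).$$
   Context: Sets in $\mathcal{F}$ are identified if their symmetric difference is a null set, and functions on $\Omega$ are identified if they coincide almost surely (a.s.). Inequalities between random variables are understood a.s. $\mathbb{N}=\{1,2,\dots\}$. For a sub-$\sigma$-algebra $\mathcal{G}\subset\mathcal{F}$: $\Pi_{\mathcal{G}}$ is the set of countable partitions $(A_k)$ of $\Omega$ with $A_k\in\mathcal{G}$ for all $k$. $L^0_{\mathcal{G}}$, $L^0_{\mathcal{G}}(\mathbb{N})$, $L^0_{\mathcal{G},+}$, $\underline{L}^0_{\mathcal{G}}$, $\bar L^0_{\mathcal{G}}$ are the spaces of $\mathcal{G}$-measurable random variables with values in $\mathbb{R}$, $\mathbb{N}$, $[0,\infty)$, $\mathbb{R}\cup\{-\infty\}$, $\mathbb{R}\cup\{\pm\infty\}$, respectively. The index $\mathcal{F}_t$ is abbreviated by $t$ (e.g. $\underline{L}^0_t=\underline{L}^0_{\mathcal{F}_t}$). Suprema of families of random variables are essential suprema; an argmax is the set of points at which this supremum is attained, and $\max$ means that it is attained. A $\mathcal{G}$-conditional metric space is a nonempty set $X$ with a function $d:X\times X\to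 L^0_{\mathcal{G},+}$ such that (i) $d(x,y)=0$ iff $x=y$; (ii) $d(x,y)=d(y,x)$; (iii) $d(x,z)\le d(x,y)+d(y,z)$; (iv) for every sequence $(x_k)$ in $X$ and $(A_k)\in\Pi_{\mathcal{G}}$ there exists exactly one $x\in X$ with $1_{A_k}d(x,x_k)=0$ for all $k$. This $x$ is called the concatenation and denoted $\sum_k1_{A_k}x_k$. Write $x_n\to x$ a.s. if $d(x,x_n)\to0$ a.s. Products of conditional metric spaces carry the maximum of the conditional metrics of the factors. For a sequence $(x_n)$ in a $\mathcal{G}$-conditional metric space and $n_k\in L^0_{\mathcal{G}}(\mathbb{N})$, $x_{n_k}:=\sum_{j\in\mathbb{N}}1_{\{n_k=j\}}x_j$. A function $f$ is $\mathcal{G}$-stable if $f(\sum_k1_{A_k}x_k)=\sum_k1_{A_k}f(x_k)$ for all $(A_k)\in\Pi_{\mathcal{G}}$ and all sequences $(x_k)$ in its domain. It is sequentially continuous if $x_k\to x$ a.s. implies $f(x_k)\to f(x)$ a.s. A function $f$ with values in a space of extended-real random variables is sequentially upper semi-continuous if $x_k\to x$ a.s. implies $\limsup_k f(x_k)\le f(x)$ a.s. On $\underline{L}^0_{t+1}$, concatenation is pointwise and $y_k\to y$ a.s. means almost sure pointwise convergence in $[-\infty,\infty)$. In the compositions, $u_s(x_s,\cdot,z_s)$ is regarded as a map $\underline{L}^0_{s+1}\to\underline{L}^0_s$, and $u_T(x_T)\in\underline{L}^0_T$ is the element to which the composition is applied. *)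

(* Defs.v *)
From HB Require Import structures.
From mathcomp Require Import all_boot all_order all_algebra.
From mathcomp Require Import all_classical all_reals all_analysis.
From mathcomp Require Import measurable_realfun.

Set Implicit Arguments.
Unset Strict Implicit.
Unset Printing Implicit Defensive.

Import Order.TTheory GRing.Theory Num.Theory.
Import numFieldNormedType.Exports.

Local Open Scope classical_set_scope.
Local Open Scope ring_scope.

(* Random variables are functions on Omega, compared with [=%[ae P]] instead
   of being quotiented; every hypothesis and conclusion below is invariant
   under modification on null sets.  Sequences are indexed from 0. *)

Section random_variables.
Context {d : measure_display} {Omega : measurableType d} {R : realType}.
Context (P : probability Omega R).

(* The G-measurable random variables with values in V, up to a null set. *)
Definition L0 {dE : measure_display} {E : measurableType dE}
    (G : set (set Omega)) (V : set E) : set (Omega -> E) :=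
  [set f | exists g : g_sigma_algebraType G -> E,
    [/\ measurable_fun setT g, range g `<=` V & f = g %[ae P]]].

Definition L0_nneg (G : set (set Omega)) : set (Omega -> R) :=
  L0 G [set r : R | 0 <= r].

Definition L0_under (G : set (set Omega)) : set (Omega -> \bar R) :=
  L0 G [set r : \bar R | (r < +oo)%E].

Definition L0_bar (G : set (set Omega)) : set (Omega -> \bar R) :=
  L0 G [set: \bar R].

Definition le_as (f g : Omega -> \bar R) : Prop :=
  \forall w \ae P, (f w <= g w)%E.

(* Blocks of a partition may be empty, so finite partitions are included. *)
Definition countable_partition (G : set (set Omega)) (A : nat -> set Omega) :=
  [/\ forall k, G (A k), trivIset setT A & \bigcup_k A k = setT].

(* f = \sum_k 1_(A k) fs k, stated piecewise because the values may be -oo. *)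
Definition rv_concat (A : nat -> set Omega) (fs : nat -> Omega -> \bar R)
    (f : Omega -> \bar R) : Prop :=
  forall k, \forall w \ae P, A k w -> f w = fs k w.

Definition rv_cvg (fs : nat -> Omega -> \bar R) (f : Omega -> \bar R) : Prop :=
  \forall w \ae P, fs n w @[n --> \oo] --> f w.

Definition rv_limsup_le (fs : nat -> Omega -> \bar R) (f : Omega -> \bar R) :=
  le_as (fun w => limn_esup (fun n => fs n w)) f.

Definition is_esup (Phi : set (Omega -> \bar R)) (y : Omega -> \bar R) : Prop :=
  [/\ L0_bar measurable y,
      forall f, Phi f -> le_as f y &
      forall y', L0_bar measurable y' -> (forall f, Phi f -> le_as f y') ->
        le_as y y'].

(* A representative of the essential supremum, which exists for every family
   of random variables by [esupP] below. *)
Definition esup (Phi : set (Omega -> \bar R)) : Omega -> \bar R :=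
  xget (fun=> -oo%E) (is_esup Phi).

Definition argmax {Z : Type} (S : set Z) (h : Z -> Omega -> \bar R) : set Z :=
  [set z | S z /\ h z = esup (h @` S) %[ae P]].

Definition is_max {Z : Type} (S : set Z) (h : Z -> Omega -> \bar R)
    (y : Omega -> \bar R) : Prop :=
  y = esup (h @` S) %[ae P] /\ argmax S h !=set0.

Definition is_concat {X : Type} (D : X -> X -> Omega -> R)
    (A : nat -> set Omega) (xs : nat -> X) (x : X) : Prop :=
  forall k, \forall w \ae P, \1_(A k) w * D x (xs k) w = 0.

Definition cvg_as {X : Type} (D : X -> X -> Omega -> R)
    (xs : nat -> X) (x : X) : Prop :=
  \forall w \ae P, D x (xs n) w @[n --> \oo] --> 0.

Definition random_indices (G : set (set Omega)) (n : nat -> Omega -> nat) :=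
  (forall k, measurable_fun setT (n k : g_sigma_algebraType G -> nat)) /\
  (forall k, \forall w \ae P, (n k w < n k.+1 w)%N).

(* xs' k is the element xs_(n k) = \sum_j 1_{n k = j} xs j. *)
Definition random_subseq {X : Type} (D : X -> X -> Omega -> R)
    (n : nat -> Omega -> nat) (xs xs' : nat -> X) : Prop :=
  forall k, is_concat D (fun j => [set w | n k w = j]) xs (xs' k).

Record cond_metric_space (G : set (set Omega)) := CondMetricSpace {
  cms_sort :> Type;
  cms_dist : cms_sort -> cms_sort -> Omega -> R;
  cms_nonempty : inhabited cms_sort;
  cms_dist_L0 : forall x y, L0_nneg G (cms_dist x y);
  cms_dist_eq0 : forall x y,
    cms_dist x y = (fun=> 0) %[ae P] <-> x = y;
  cms_dist_sym : forall x y, cms_dist x y = cms_dist y x %[ae P];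
  cms_dist_triangle : forall x y z,
    \forall w \ae P, cms_dist x z w <= cms_dist x y w + cms_dist y z w;
  cms_concat : forall (xs : nat -> cms_sort) (A : nat -> set Omega),
    countable_partition G A -> exists! x, is_concat cms_dist A xs x
}.

Definition prod_dist {X Z : Type} (DX : X -> X -> Omega -> R)
    (DZ : Z -> Z -> Omega -> R) (p q : X * Z) : Omega -> R :=
  fun w => Num.max (DX p.1 q.1 w) (DZ p.2 q.2 w).

Definition rv_stable {X : Type} (G : set (set Omega))
    (D : X -> X -> Omega -> R) (f : X -> Omega -> \bar R) : Prop :=
  forall A xs x, countable_partition G A -> is_concat D A xs x ->
    rv_concat A (fun k => f (xs k)) (f x).

Definition rv_usc {X : Type} (D : X -> X -> Omega -> R)
    (f : X -> Omega -> \bar R) : Prop :=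
  forall xs x, cvg_as D xs x -> rv_limsup_le (fun n => f (xs n)) (f x).

End random_variables.

Arguments cms_dist {d Omega R P G} _ _ _ _.

Section esup_theory.
Context {d : measure_display} {Omega : measurableType d} {R : realType}.
Context (P : probability Omega R).

Lemma countable_cover (I : Type) (S : set I) (B : I -> set Omega) :
  S !=set0 -> (forall i, S i -> measurable (B i)) ->
  exists s : nat -> I, (forall n, S (s n)) /\
    forall i, S i -> P.-negligible (B i `\` \bigcup_n B (s n)).
Proof.
move=> [i0 Si0] mB; pose U (s : nat -> I) := \bigcup_n B (s n).
have mU s : (forall n, S (s n)) -> measurable (U s).
  by move=> Ss; apply: bigcupT_measurable => n; exact/mB/Ss.
pose V := [set P (U s) | s in [set s | forall n, S (s n)]].
have V1 : (ereal_sup V <= 1)%E.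
  by apply: ge_ereal_sup => _ [s /mU mUs <-]; exact: probability_le1.
have V0 : (0 <= ereal_sup V)%E.
  apply: (@le_trans _ _ (P (U (fun=> i0)))) => //.
  by apply: ereal_sup_ubound; exists (fun=> i0).
have Vfin : ereal_sup V \is a fin_num.
  by rewrite ge0_fin_numE// (le_lt_trans V1)// ltry.
have /choice[c cP] : forall k : nat, exists s : nat -> I,
    (forall n, S (s n)) /\ (ereal_sup V - (k.+1%:R^-1)%:E < P (U s))%E.
  move=> k; have k0 : (0 < k.+1%:R^-1 :> R) by rewrite invr_gt0.
  by have [_ [s Ss <-] lts] := ub_ereal_sup_adherent k0 Vfin; exists s.
pose s m := if @unpickle (nat * nat)%type m is Some (k, n) then c k n else i0.
have Ss m : S (s m).
  by rewrite /s; case: unpickle => [[k n]|]//; have [+ _] := cP k; exact.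
have cs k : U (c k) `<=` U s.
  by move=> w [n _ wn]; exists (pickle (k, n)) => //=; rewrite /s pickleK.
have PUs : P (U s) = ereal_sup V.
  apply/eqP; rewrite eq_le; apply/andP; split.
    by apply: ereal_sup_ubound; exists s.
  apply/lee_addgt0Pr => e e0.
  have [k _ /(_ k (leqnn k)) ke] := near_infty_natSinv_lt (PosNum e0).
  rewrite -leeBlDr//; have [Sc /ltW] := cP k.
  move=> /le_trans => /(_ (P (U s))) H; apply: le_trans (H _).
    by apply: leeB => //; rewrite lee_fin ltW.
  by apply: le_measure; rewrite ?inE//; exact: mU.
exists s; split=> // i Si; exists (B i `\` U s); split=> //.
  by apply: measurableD; [exact: mB|exact: mU].
pose s' n := if n is m.+1 then s m else i.
have Ss' n : S (s' n) by case: n => //=.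
have Us' : U s' = U s `|` (B i `\` U s).
  apply/seteqP; split => w.
    move=> [[_ /= Biw|n _ sw]]; last by left; exists n.
    by have [|nU] := pselect (U s w); [left|right].
  by case=> [[n _ sw]|[Biw _]]; [exists n.+1|exists 0%N].
have : (P (U s') <= P (U s))%E.
  by rewrite PUs; apply: ereal_sup_ubound; exists s'.
rewrite Us' measureU//; last 3 first.
- exact: mU.
- by apply: measurableD; [exact: mB|exact: mU].
- by rewrite setDE setICA setICr setI0.
rewrite -leeBrDl /= PUs// subee// => h.
by apply/eqP; rewrite eq_le h measure_ge0.
Qed.

Lemma L0_bar_measurableP (f : Omega -> \bar R) :
  L0_bar P measurable f <->
  exists2 g : Omega -> \bar R, measurable_fun setT g & f = g %[ae P].
Proof.
have E : <<s (@measurable _ Omega) >> = measurable.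
  exact/sigma_algebra_id/sigma_algebra_measurable.
split=> [[g [mg _ fg]]|[g mg fg]]; exists g => //.
  by move=> _ B mB; rewrite -E; exact: mg.
by split=> // _ B mB; rewrite /measurable/= E; exact: mg.
Qed.

Lemma is_esup_exists (Phi : set (Omega -> \bar R)) :
  (forall f, Phi f -> L0_bar P measurable f) -> exists y, is_esup P Phi y.
Proof.
move=> mPhi; have [Phi0|/set0P[f0 Phif0]] := eqVneq Phi set0.
  exists (fun=> -oo%E); split.
  - by apply/L0_bar_measurableP; exists (fun=> -oo%E) => //; exact/aeW.
  - by rewrite Phi0.
  - by move=> y' _ _; apply: aeW => w; rewrite leNye.
pose S := [set g : Omega -> \bar R | measurable_fun setT g /\
                                     exists2 f, Phi f & f = g %[ae P]].
have [g0 Sg0] : S !=set0.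
  by have /L0_bar_measurableP[g mg fg] := mPhi _ Phif0; exists g; split=> //; exists f0.
have /choice[c cP] : forall q : rat, exists s : nat -> Omega -> \bar R,
    (forall n, S (s n)) /\ forall g, S g ->
    P.-negligible ([set w | (ratr q)%:E < g w]%E `\`
                   \bigcup_n [set w | (ratr q)%:E < s n w]%E).
  move=> q; apply: countable_cover; first by exists g0.
  by move=> g [mg _]; rewrite -[X in measurable X]setTI;
    exact: emeasurable_fun_o_infty.
pose s m := if @unpickle (rat * nat)%type m is Some (q, n) then c q n else g0.
have Ss m : S (s m).
  by rewrite /s; case: unpickle => [[q n]|]//; have [+ _] := cP q; exact.
pose y w := esups (s ^~ w) 0.
have sy m w : (s m w <= y w)%E by apply: ereal_sup_ubound; exists m.
exists y; split.
- apply/L0_bar_measurableP; exists y; last exact/aeW.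
  by apply: measurable_fun_esups => n; have [] := Ss n.
- move=> f Phif; have /L0_bar_measurableP[g mg fg] := mPhi _ Phif.
  have Sg : S g by split=> //; exists f.
  have : \forall w \ae P, forall n : nat, if @unpickle rat n is Some q then
      ~ ([set w | (ratr q)%:E < g w]%E `\`
         \bigcup_n [set w | (ratr q)%:E < c q n w]%E) w else True.
    apply/ae_foralln => n; case: unpickle => [q|]; last exact/aeW.
    have [_ /(_ _ Sg)] := cP q.
    by rewrite /prop_near1 /nbhs/= /almost_everywhere; congr (P.-negligible);
      apply/seteqP; split=> w /= => [h /(_ h)//|/contrapT].
  apply: filterS2 fg => w /(_ I) -> H; rewrite leNgt; apply/negP => yg.
  have [q /andP[yq qg]] : exists q : rat, (y w <= (ratr q)%:E < g w)%E.
    move: yg; case: (y w) (g w) => [a| |] [b| |]// ab.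
    + by have [q /itvP qab] := rat_in_itvoo ab; exists q; rewrite lee_fin lte_fin !qab.
    + have : a < a + 1 by rewrite ltrDl.
      by move=> /rat_in_itvoo[q /itvP qab]; exists q; rewrite lee_fin ltry !qab.
    + have : b - 1 < b by rewrite gtrDl ltrN10.
      by move=> /rat_in_itvoo[q /itvP qab]; exists q; rewrite leNye lte_fin !qab.
    + by exists 0; rewrite leNye ltry.
  have := H (pickle q); rewrite pickleK; apply; split=> //= -[n _ /=].
  apply/negP; rewrite -leNgt (le_trans _ yq)//.
  by have := sy (pickle (q, n)) w; rewrite /s pickleK.
- move=> y' _ ub; have : \forall w \ae P, forall m, (s m w <= y' w)%E.
    apply/ae_foralln => m; have [_ [f /ub fy' fs]] := Ss m.
    by apply: filterS2 fs fy' => w /(_ I) ->.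
  by apply: filterS => w h; apply: ge_ereal_sup => _ [m _ <-].
Qed.

Lemma esupP (Phi : set (Omega -> \bar R)) :
  (forall f, Phi f -> L0_bar P measurable f) -> is_esup P Phi (esup P Phi).
Proof. by move=> /is_esup_exists; exact: xgetPex. Qed.

End esup_theory.

Section control_problem.
Context {d : measure_display} {Omega : measurableType d} {R : realType}.
Context (P : probability Omega R).

Definition is_filtration (T : nat) (F : nat -> set (set Omega)) : Prop :=
  [/\ forall t, (t <= T)%N -> sigma_algebra setT (F t),
      forall t, (t < T)%N -> F t `<=` F t.+1 &
      F T = measurable].

(* Families are indexed by all of nat instead of {0, ..., T}.  Components beyond
   the horizon play no role, and since conditional metric spaces are nonempty
   every family on {0, ..., T} extends to one on nat. *)
Context (T : nat) (F : nat -> set (set Omega)).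
Context (X Z : forall t, cond_metric_space P (F t)).

(* \sum_k 1_(A k) Theta (xs k) as a set of concatenations *)
Definition set_concat {Y : Type} (D : Y -> Y -> Omega -> R)
    (A : nat -> set Omega) (S : nat -> set Y) : set Y :=
  [set z | exists2 zs : nat -> Y, forall k, S k (zs k) & is_concat P D A zs z].

Definition admissible_constraint (t : nat) (Theta : X t -> set (Z t)) : Prop :=
  [/\ forall x, Theta x !=set0,
      forall A xs x, countable_partition (F t) A ->
        is_concat P (cms_dist (X t)) A xs x ->
        Theta x = set_concat (cms_dist (Z t)) A (fun k => Theta (xs k)),
      forall x (zs : nat -> Z t), (forall n, Theta x (zs n)) ->
        exists (n : nat -> Omega -> nat) (zs' : nat -> Z t) (z : Z t),
          [/\ random_indices P (F t) n,
              random_subseq P (cms_dist (Z t)) n zs zs',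
              Theta x z & cvg_as P (cms_dist (Z t)) zs' z] &
      forall (xs : nat -> X t) x (zs : nat -> Z t),
        cvg_as P (cms_dist (X t)) xs x -> (forall n, Theta (xs n) (zs n)) ->
        exists (n : nat -> Omega -> nat) (zs' zs'' : nat -> Z t),
          [/\ random_indices P (F t) n,
              random_subseq P (cms_dist (Z t)) n zs zs',
              forall k, Theta x (zs'' k) &
              \forall w \ae P, cms_dist (Z t) (zs' k) (zs'' k) w
                                @[k --> \oo] --> 0]].

Definition admissible_transition (t : nat) (v : X t * Z t -> X t.+1) : Prop :=
  let D := prod_dist (cms_dist (X t)) (cms_dist (Z t)) in
  (forall A ps p, countable_partition (F t) A -> is_concat P D A ps p ->
     is_concat P (cms_dist (X t.+1)) A (fun k => v (ps k)) (v p)) /\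
  (forall ps p, cvg_as P D ps p ->
     cvg_as P (cms_dist (X t.+1)) (fun k => v (ps k)) (v p)).

(* u is only specified on representatives of elements of the space
   L0_under (F t.+1); that it respects a.s. equality follows from
   monotonicity in y. *)
Definition admissible_generator (t : nat)
    (u : X t -> (Omega -> \bar R) -> Z t -> Omega -> \bar R) : Prop :=
  let D := prod_dist (cms_dist (X t)) (cms_dist (Z t)) in
  let L := L0_under P (F t.+1) in
  [/\ forall x y z, L y -> L0_under P (F t) (u x y z),
      forall A ps ys p y, countable_partition (F t) A ->
        (forall k, L (ys k)) -> L y ->
        is_concat P D A ps p -> rv_concat P A ys y ->
        rv_concat P A (fun k => u (ps k).1 (ys k) (ps k).2) (u p.1 y p.2),
      forall x y y' z, L y -> L y' ->
        le_as P y y' -> le_as P (u x y z) (u x y' z) &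
      forall ps ys p y, (forall k, L (ys k)) -> L y ->
        cvg_as P D ps p -> rv_cvg P ys y ->
        rv_limsup_le P (fun k => u (ps k).1 (ys k) (ps k).2) (u p.1 y p.2)].

Context (Theta : forall t, X t -> set (Z t)).
Context (v : forall t, X t * Z t -> X t.+1).
Context (u : forall t, X t -> (Omega -> \bar R) -> Z t -> Omega -> \bar R).
Context (uT : X T -> Omega -> \bar R).

(* The process also carries its starting point x_t, and its
   components outside the time window are arbitrary. *)
Definition admissible_paths (t : nat) (xt : X t) :
    set ((forall s, X s) * (forall s, Z s)) :=
  [set p | p.1 t = xt /\
     forall s, (t <= s < T)%N ->
       p.1 s.+1 = v (p.1 s, p.2 s) /\ Theta (p.1 s) (p.2 s)].

(* u_t(x_t, ., z_t) o ... o u_(T-1)(x_(T-1), ., z_(T-1)) applied to u_T(x_T) *)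
Definition objective (t : nat) (p : (forall s, X s) * (forall s, Z s)) :
    Omega -> \bar R :=
  foldr (fun s y => u (p.1 s) y (p.2 s)) (uT (p.1 T)) (index_iota t T).

End control_problem.

(* Main.v *)
Require Import Defs.
From HB Require Import structures.
From mathcomp Require Import all_boot all_order all_algebra.
From mathcomp Require Import all_classical all_reals all_analysis.
From mathcomp Require Import measurable_realfun.

Set Implicit Arguments.
Unset Strict Implicit.
Unset Printing Implicit Defensive.

Import Order.TTheory GRing.Theory Num.Theory.
Import numFieldNormedType.Exports.

Local Open Scope classical_set_scope.
Local Open Scope ring_scope.

(** One step of the recursion maximizes a stable, sequentially upper
    semi-continuous function [h (x, z)] over [z] in [Theta x].  Since [Theta x]
    is closed under countable concatenation, the values [h (x, z)] are directed
    upwards, and random subsequences of a maximizing sequence converge to a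
    point of [Theta x], where the essential supremum is attained.  For the upper
    semi-continuity of the value function along [xs n --> x], one pastes, for
    each rational [q], the first optimal pair of index at least [k] whose value
    exceeds [q]; these pairs have a limit point over [x], so the value at [x] is
    at least [q] wherever the limsup exceeds [q].  Stability and semicontinuity
    thus propagate backwards in time, and attained maxima can be pasted into an
    optimal path. *)

(** * Limsups and rational levels in the extended reals *)

Section real_sequences.
Context {R : realType}.
Implicit Types (u : nat -> \bar R) (a b : \bar R).

Lemma limn_esup_lt u b : (limn_esup u < b)%E ->
  \forall n \near \oo, (u n < b)%E.
Proof.
move=> /ereal_inf_lt[_ [V Voo <-] uVb]; apply: filterS Voo => n Vn.
by apply: le_lt_trans uVb; apply: ereal_sup_ubound; exists n.
Qed.

Lemma limn_esup_le u a : (\forall n \near \oo, (u n <= a)%E) ->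
  (limn_esup u <= a)%E.
Proof.
move=> ua; apply: (@le_trans _ _ (ereal_sup (u @` [set n | (u n <= a)%E]))).
  by apply: ereal_inf_lbound; exists [set n | (u n <= a)%E].
by apply: ge_ereal_sup => _ [n ? <-].
Qed.

Lemma le_limn_esup u a : (\forall n \near \oo, (a <= u n)%E) ->
  (a <= limn_esup u)%E.
Proof.
move=> au; apply: le_ereal_inf_tmp => _ [V Voo <-].
have [n [Vn aun]] := @filter_ex _ _ _ _ (filterI Voo au).
by apply: le_trans aun _; apply: ereal_sup_ubound; exists n.
Qed.

Lemma limn_esup_gt_frequently u a k : (a < limn_esup u)%E ->
  exists2 n, (k <= n)%N & (a < u n)%E.
Proof.
move=> au; apply: contrapT => nau; move: au; apply/negP; rewrite -leNgt.
apply: limn_esup_le; exists k => // n /= kn; rewrite leNgt; apply/negP => aun.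
by apply: nau; exists n.
Qed.

(** Reduces an inequality to countably many implications with rational levels. When [a] and [b]
    depend on the sample point, each level can then be treated with its own null set. *)
Lemma le_rat_lt a b :
  (forall q : rat, ((ratr q)%:E < a)%E -> ((ratr q)%:E <= b)%E) -> (a <= b)%E.
Proof.
move=> h; rewrite leNgt; apply/negP => ba.
suff [q /andP[bq qa]] : exists q : rat, (b < (ratr q)%:E < a)%E.
  by have := le_lt_trans (h q qa) bq; rewrite ltxx.
move: ba {h}; case: a b => [a| |] [b| |]// ba.
- by have [q /itvP qab] := rat_in_itvoo ba; exists q; rewrite !lte_fin !qab.
- have : a - 1 < a by rewrite gtrDl ltrN10.
  by move=> /rat_in_itvoo[q /itvP qab]; exists q; rewrite ltNyr lte_fin !qab.
- have : b < b + 1 by rewrite ltrDl.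
  by move=> /rat_in_itvoo[q /itvP qab]; exists q; rewrite lte_fin ltry !qab.
- by exists 0; rewrite ltNyr ltry.
Qed.

(** The maximum with [b] keeps the sequence above [b], so only its limsup has to be controlled. This
    turns upper semi-continuity into genuine convergence. *)
Lemma cvg_maxe_limn_esup u b : (limn_esup u <= b)%E ->
  (fun n => maxe (u n) b) @ \oo --> b.
Proof.
move=> ub; apply: limn_esup_le_cvg => [|n]; last by rewrite le_max lexx orbT.
apply/le_rat_lt => q qL; rewrite leNgt; apply/negP => bq.
suff : (limn_esup (fun n => maxe (u n) b) <= (ratr q)%:E)%E by rewrite leNgt qL.
apply: limn_esup_le; apply: filterS (limn_esup_lt (le_lt_trans ub bq)) => n un.
by rewrite ge_max !ltW.
Qed.

(** The index [n] need not increase with [k]; staying above [k] is enough. This is applied at a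
    fixed sample point to random subsequences and to pasted sequences. *)
Lemma cvg_reindex (a b : nat -> R) (l : R) : a @ \oo --> l ->
  (forall k, exists2 n, (k <= n)%N & b k = a n) -> b @ \oo --> l.
Proof.
move=> /cvgrPdist_lt al ba; apply/cvgrPdist_lt => e /al[m _ lam].
by exists m => // k /= mk; have [n kn ->] := ba k;
  apply: lam => /=; exact: leq_trans kn.
Qed.

End real_sequences.

(** * Almost sure statements and measurable versions *)

Section random_variables.
Context {d : measure_display} {Omega : measurableType d} {R : realType}.
Context (P : probability Omega R).

Lemma ae_eqP {U : Type} (f g : Omega -> U) :
  f = g %[ae P] <-> \forall w \ae P, f w = g w.
Proof.
split=> h; last exact: filterS h.
by apply: filterS h => w /(_ I).
Qed.

Lemma ae_and (Q Q' : Omega -> Prop) : (\forall w \ae P, Q w) ->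
  (\forall w \ae P, Q' w) -> \forall w \ae P, Q w /\ Q' w.
Proof. exact: filterI. Qed.

(** There is one null set for each pair [(k, j)]; off their countable union a random subsequence can
    be evaluated at its random index. *)
Lemma ae_index {T : Type} (n : nat -> Omega -> nat) (f f' : nat -> Omega -> T) :
  (forall k j, \forall w \ae P, n k w = j -> f' k w = f j w) ->
  \forall w \ae P, forall k, f' k w = f (n k w) w.
Proof.
move=> H; have : \forall w \ae P, forall k j, n k w = j -> f' k w = f j w.
  by apply/ae_foralln => k; apply/ae_foralln => j; exact: H.
by apply: filterS => w + k; exact.
Qed.

Lemma ae_forall_countable {T : countType} (Q : T -> Omega -> Prop) :
  (forall t, \forall w \ae P, Q t w) -> \forall w \ae P, forall t, Q t w.
Proof.
move=> hQ.
have : \forall w \ae P, forall n : nat,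
    if @unpickle T n is Some t then Q t w else True.
  by apply/ae_foralln => n; case: unpickle => [t|]; [exact: hQ|exact: aeW].
by apply: filterS => w Qw t; have := Qw (pickle t); rewrite pickleK.
Qed.

Lemma measurable_gen (G : set (set Omega)) (A : set Omega) :
  sigma_algebra setT G -> measurable (A : set (g_sigma_algebraType G)) -> G A.
Proof. by move=> sG; rewrite /measurable/= sigma_algebra_id. Qed.

Lemma L0_sub {dE : measure_display} {E : measurableType dE}
    (G G' : set (set Omega)) (V V' : set E) (f : Omega -> E) :
  G `<=` G' -> V `<=` V' -> L0 P G V f -> L0 P G' V' f.
Proof.
move=> GG' VV' [g [mg gV fg]]; exists g.
split=> //; last exact: subset_trans VV'.
move=> mT B mB; have := mg measurableT B mB; rewrite /measurable/=.
exact: sub_sigma_algebra2.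
Qed.

Lemma L0_ae {dE : measure_display} {E : measurableType dE}
    (G : set (set Omega)) (V : set E) (f f' : Omega -> E) :
  f = f' %[ae P] -> L0 P G V f' -> L0 P G V f.
Proof.
move=> ff' [g [mg gV f'g]]; exists g.
by split=> //; exact: ae_eq_trans f'g.
Qed.

Lemma L0_under_version (G : set (set Omega)) (f : Omega -> \bar R) :
  L0_under P G f -> exists2 g : Omega -> \bar R,
    measurable_fun setT (g : g_sigma_algebraType G -> \bar R) &
    \forall w \ae P, f w = g w.
Proof. by move=> [g [mg _ /ae_eqP fg]]; exists g. Qed.

Lemma L0_under_maxe (G : set (set Omega)) (f g : Omega -> \bar R) :
  L0_under P G f -> L0_under P G g ->
  L0_under P G (fun w => maxe (f w) (g w)).
Proof.
move=> [f' [mf f'y /ae_eqP ff']] [g' [mg g'y /ae_eqP gg']].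
exists (fun w => maxe (f' w) (g' w)); split.
- exact: measurable_maxe.
- by move=> _ [w _ <-] /=; rewrite gt_max (f'y (f' w)) ?(g'y (g' w))//;
     exists w.
- by apply/ae_eqP; apply: filterS2 ff' gg' => w -> ->.
Qed.

(** The largest element [h z] lies in the family and is itself a measurable upper bound, so the
    least upper bound is squeezed onto it. *)
Lemma esup_attained {Z : Type} (S : set Z) (h : Z -> Omega -> \bar R) z :
  (forall z, S z -> L0_bar P measurable (h z)) -> S z ->
  (forall z', S z' -> le_as P (h z') (h z)) ->
  esup P (h @` S) = h z %[ae P].
Proof.
move=> mh Sz hz.
have [_ ub lub] : is_esup P (h @` S) (esup P (h @` S)).
  by apply: esupP => _ [z' Sz' <-]; exact: mh.
have := lub _ (mh _ Sz); have : le_as P (h z) (esup P (h @` S)).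
  by apply: ub; exists z.
move=> le1 /(_ _)/wrap[_ [z' Sz' <-]|le2]; first exact: hz.
by apply: filterS2 le1 le2 => w h1 h2 _; apply/eqP; rewrite eq_le h1 h2.
Qed.

End random_variables.

(** * Concatenations, random subsequences and partitions *)

Section concatenation.
Context {d : measure_display} {Omega : measurableType d} {R : realType}.
Context (P : probability Omega R) (G : set (set Omega)).
Hypothesis sG : sigma_algebra setT G.

Lemma is_concatP {Y : Type} (D : Y -> Y -> Omega -> R) A (xs : nat -> Y) x :
  is_concat P D A xs x <->
  forall k, \forall w \ae P, A k w -> D x (xs k) w = 0.
Proof.
split=> h k; apply: filterS (h k) => w.
  by move=> + Akw; rewrite indicE mem_set// mul1r.
rewrite indicE; have [/set_mem Akw /(_ Akw) ->|_ _] := boolP (w \in A k).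
  by rewrite mulr0.
by rewrite mul0r.
Qed.

Lemma is_concat_pair {Y W : Type} (D : Y -> Y -> Omega -> R)
    (D' : W -> W -> Omega -> R) A xs x zs z :
  is_concat P D A xs x -> is_concat P D' A zs z ->
  is_concat P (prod_dist D D') A (fun k => (xs k, zs k)) (x, z).
Proof.
move=> /is_concatP cx /is_concatP cz; apply/is_concatP => k.
apply: filterS2 (cx k) (cz k) => w xk zk Akw.
by rewrite /prod_dist/= xk// zk// maxxx.
Qed.

Lemma cvg_as_pair {Y W : Type} (D : Y -> Y -> Omega -> R)
    (D' : W -> W -> Omega -> R) xs x zs z :
  cvg_as P D xs x -> cvg_as P D' zs z ->
  cvg_as P (prod_dist D D') (fun k => (xs k, zs k)) (x, z).
Proof.
move=> cx cz; apply: filterS2 cx cz => w /cvgrPdist_lt xw /cvgrPdist_lt zw.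
apply/cvgrPdist_lt => e e0; apply: filterS2 (xw e e0) (zw e e0) => n.
by rewrite /prod_dist/= /Num.max; case: ifP.
Qed.

Section cond_metric.
Context (Y : cond_metric_space P G).
Local Notation D := (cms_dist Y).

Lemma dist_refl x : \forall w \ae P, D x x w = 0.
Proof. by apply/ae_eqP/cms_dist_eq0. Qed.

Lemma dist_ge0 x x' : \forall w \ae P, 0 <= D x x' w.
Proof.
have [g [_ g0 /ae_eqP]] := cms_dist_L0 x x'.
by apply: filterS => w ->; apply: g0; exists w.
Qed.

Lemma cvg_as_cst x : cvg_as P D (fun=> x) x.
Proof. by apply: filterS (dist_refl x) => w ->; exact: cvg_cst. Qed.

Lemma is_concat_cst A x : is_concat P D A (fun=> x) x.
Proof. by apply/is_concatP => k; apply: filterS (dist_refl x). Qed.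

(** On [A k] the points [x] and [xs k] are at distance 0, so two triangle inequalities give both
    bounds. *)
Lemma concat_dist A xs x : is_concat P D A xs x ->
  forall a k, \forall w \ae P, A k w -> D a x w = D a (xs k) w.
Proof.
move=> /is_concatP cx a k.
have sxk := proj1 (ae_eqP _ _ _) (cms_dist_sym x (xs k)).
have tri := ae_and (cms_dist_triangle a x (xs k))
  (cms_dist_triangle a (xs k) x).
apply: filterS3 (cx k) sxk tri => w xk sk [t1 t2] Akw.
have := xk Akw => xk0; apply/eqP; rewrite eq_le.
by move: t1 t2; rewrite -sk xk0 !addr0 => -> ->.
Qed.

Lemma concat_ex A xs : countable_partition G A ->
  exists x, is_concat P D A xs x.
Proof. by move=> /(cms_concat xs)[x [+ _]]; exists x. Qed.

End cond_metric.

Lemma partition_index (n : Omega -> nat) :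
  measurable_fun setT (n : g_sigma_algebraType G -> nat) ->
  countable_partition G (fun j => [set w | n w = j]).
Proof.
move=> mn; split.
- move=> k; apply: measurable_gen => //.
  by have := mn measurableT [set k] I; rewrite setTI.
- by move=> i j _ _ [w [/= <- <-]].
- by apply/seteqP; split => // w _; exists (n w).
Qed.

Lemma random_indices_ge (n : nat -> Omega -> nat) : random_indices P G n ->
  \forall w \ae P, forall k, (k <= n k w)%N.
Proof.
move=> [_ /ae_foralln]; apply: filterS => w nw.
by elim=> // k IHk; exact: leq_ltn_trans (nw k).
Qed.

(** The partition records the first [n] with [B n]: block [n.+1] is [B n] minus the earlier sets,
    and block 0 is left for the points where no such [n] exists. *)
Lemma partition_first (B : nat -> set Omega) : (forall n, G (B n)) ->
  exists2 A, countable_partition G A &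
    A 0%N = ~` (\bigcup_n B n) /\ forall n, A n.+1 `<=` B n.
Proof.
move=> GB.
pose A n := if n is m.+1 then seqDU B m else ~` (\bigcup_n B n).
have mB n : measurable (B n : set (g_sigma_algebraType G)).
  exact: sub_sigma_algebra.
exists A; last by split=> // n; exact: subset_seqDU.
split.
- move=> [|n]; apply: measurable_gen => //.
    by apply: measurableC; exact: bigcupT_measurable.
  exact: seqDU_measurable.
- move=> [|i] [|j] _ _ //= [w [/=]].
  + by move=> nB; rewrite seqDU_bigcup_eq in nB; move=> Bw; case: nB; exists j.
  + by move=> Bw; rewrite seqDU_bigcup_eq; case; exists i.
  + by move=> wi wj; congr _.+1; apply: (@trivIset_seqDU _ B i j I I); exists w.
- apply/seteqP; split => // w _; have [Bw|] := pselect ((\bigcup_n B n) w).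
    by move: Bw; rewrite seqDU_bigcup_eq => -[n _ Bnw]; exists n.+1.
  by exists 0%N.
Qed.

End concatenation.

(** * Maximization of a stable, semi-continuous function over [Theta x] *)

Section one_step.
Context {d : measure_display} {Omega : measurableType d} {R : realType}.
Context (P : probability Omega R) (G : set (set Omega)).
Hypotheses (sG : sigma_algebra setT G) (GF : G `<=` measurable).
Context (X Z : cond_metric_space P G) (Theta : X -> set Z).
Local Notation DX := (cms_dist X).
Local Notation DZ := (cms_dist Z).

Hypothesis Theta_neq0 : forall x, Theta x !=set0.
Hypothesis Theta_stable : forall A xs x, countable_partition G A ->
  is_concat P DX A xs x ->
  Theta x = set_concat P DZ A (fun k => Theta (xs k)).
Hypothesis Theta_compact : forall x (zs : nat -> Z),
  (forall n, Theta x (zs n)) ->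
  exists (n : nat -> Omega -> nat) (zs' : nat -> Z) (z : Z),
    [/\ random_indices P G n, random_subseq P DZ n zs zs',
        Theta x z & cvg_as P DZ zs' z].
Hypothesis Theta_usc : forall (xs : nat -> X) x (zs : nat -> Z),
  cvg_as P DX xs x -> (forall n, Theta (xs n) (zs n)) ->
  exists (n : nat -> Omega -> nat) (zs' zs'' : nat -> Z),
    [/\ random_indices P G n, random_subseq P DZ n zs zs',
        forall k, Theta x (zs'' k) &
        \forall w \ae P, DZ (zs' k) (zs'' k) w @[k --> \oo] --> 0].

Variable h : X * Z -> Omega -> \bar R.
Hypothesis h_under : forall p, L0_under P G (h p).
Hypothesis h_stable : rv_stable P G (prod_dist DX DZ) h.
Hypothesis h_usc : rv_usc P (prod_dist DX DZ) h.

Lemma Theta_concat A xs x zs z : countable_partition G A ->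
  is_concat P DX A xs x -> is_concat P DZ A zs z ->
  (forall k, Theta (xs k) (zs k)) -> Theta x z.
Proof. by move=> pA cx cz Tz; rewrite (Theta_stable pA cx); exists zs. Qed.

(** A random subsequence of [zs] approaches points of [Theta x], and these have a further random
    subsequence converging in [Theta x]. By stability, [h] along the composed subsequence takes
    values of the original sequence at random indices, so an eventual lower bound survives and
    semi-continuity carries it to the limit. *)
Lemma Theta_limit xs x zs : cvg_as P DX xs x ->
  (forall n, Theta (xs n) (zs n)) ->
  exists2 z, Theta x z & \forall w \ae P, forall a,
    (\forall n \near \oo, (a <= h (xs n, zs n) w)%E) -> (a <= h (x, z) w)%E.
Proof.
move=> cx Tz; have [n [zs1 [zs2 [rn sz1 Tz2 d12]]]] := Theta_usc cx Tz.
have [l [zs3 [z [rl sz3 Txz cz3]]]] := Theta_compact Tz2.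
have pn k := partition_index sG (rn.1 k).
have pl k := partition_index sG (rl.1 k).
(* The pairs [(xs4 k, zs4 k)] are the original ones at the composed random index [n (l k w) w],
   which is at least [k]. *)
have /choice[xs1 cx1] := fun k => concat_ex xs (pn k).
have /choice[xs4 cx4] := fun k => concat_ex xs1 (pl k).
have /choice[zs4 cz4] := fun k => concat_ex zs1 (pl k).
have nk := random_indices_ge rn; have lk := random_indices_ge rl.
exists z => //.
have c4x : cvg_as P DX xs4 x.
  have e1 := ae_index (fun k j => concat_dist (cx1 k) x j).
  have e4 := ae_index (fun k j => concat_dist (cx4 k) x j).
  apply: filterS3 cx (ae_and nk lk) (ae_and e1 e4) => w cxw [nw lw] [e1w e4w].
  apply: cvg_reindex cxw _ => k; exists (n (l k w) w).
    exact: leq_trans (lw k) (nw _).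
  by rewrite e4w e1w.
(* Compare [zs4] with [zs3], which converges to [z]: their distance is that of [zs1] and [zs2] at
   the index [l k w], and it tends to 0. *)
have c4z : cvg_as P DZ zs4 z.
  have e34 : \forall w \ae P, forall k,
      DZ (zs3 k) (zs4 k) w = DZ (zs1 (l k w)) (zs2 (l k w)) w.
    apply: (ae_index (n := l) (f := fun j => DZ (zs1 j) (zs2 j))
                     (f' := fun k => DZ (zs3 k) (zs4 k))) => k j.
    have sym := proj1 (ae_eqP _ _ _) (cms_dist_sym (zs3 k) (zs1 j)).
    apply: filterS3 (concat_dist (cz4 k) (zs3 k) j)
      (concat_dist (sz3 k) (zs1 j) j) sym => w e4 e3 s kj.
    by rewrite e4// s e3.
  have tri : \forall w \ae P, forall k,
      0 <= DZ z (zs4 k) w <= DZ z (zs3 k) w + DZ (zs3 k) (zs4 k) w.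
    apply/ae_foralln => k.
    apply: filterS2 (dist_ge0 z (zs4 k))
      (cms_dist_triangle z (zs3 k) (zs4 k)) => w -> -> //.
  apply: filterS3 (ae_and lk cz3) (ae_and d12 e34) tri => w [lw c3] [c12 e] t.
  apply: (squeeze_cvgr (f := cst 0)
    (h := fun k => DZ z (zs3 k) w + DZ (zs3 k) (zs4 k) w)).
  - exact: nearW.
  - exact: cvg_cst.
  - rewrite -[X in _ --> X](addr0 (0 : R)); apply: cvgD => //.
    by apply: cvg_reindex c12 _ => k; exists (l k w).
have e1 := ae_index (fun k => h_stable (pn k) (is_concat_pair (cx1 k) (sz1 k))).
have e4 := ae_index (fun k => h_stable (pl k) (is_concat_pair (cx4 k) (cz4 k))).
have hu := h_usc (cvg_as_pair c4x c4z).
apply: filterS3 (ae_and nk lk) (ae_and e1 e4) hu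
  => w [nw lw] [e1w e4w] huw a [m _ ma].
apply: le_trans huw; apply: le_limn_esup; exists m => // k /= mk.
rewrite e4w e1w; apply: ma => /=.
by rewrite (leq_trans mk)// (leq_trans (lw k)).
Qed.

(** Paste [z'] on the event where its value is strictly larger, and [z] elsewhere. *)
Lemma Theta_directed x z z' : Theta x z -> Theta x z' ->
  exists z'', [/\ Theta x z'', le_as P (h (x, z)) (h (x, z'')) &
    le_as P (h (x, z')) (h (x, z''))].
Proof.
move=> Tz Tz'; have [g mg hg] := L0_under_version (h_under (x, z)).
have [g' mg' hg'] := L0_under_version (h_under (x, z')).
have Glt : G [set w | (g w < g' w)%E].
  apply: measurable_gen => //; rewrite -[X in measurable X]setTI.
  exact: measurable_lte.
(* The family is constant, so block 0 is the event [g' <= g] and every later block lies in the event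
   [g < g']. *)
have [A pA [A0 Alt]] := partition_first sG (fun _ : nat => Glt).
pose zs k := if k is 0%N then z else z'.
have [z'' cz] := concat_ex zs pA.
have e := h_stable pA (is_concat_pair (is_concat_cst A x) cz).
have hz : \forall w \ae P, (g w <= h (x, z'') w)%E /\ (g' w <= h (x, z'') w)%E.
  have [_ _ AT] := pA.
  apply: filterS3 hg hg' ((ae_foralln e)) => w gw gw' ew.
  have : (\bigcup_k A k) w by rewrite AT.
  case=> -[|k] _ Akw; rewrite (ew _ Akw)/= ?gw ?gw'; last first.
    by rewrite lexx ltW//; exact: Alt Akw.
  rewrite lexx leNgt; split=> //; apply/negP => gg'.
  by move: Akw; rewrite A0 => -[]; exists 0%N.
exists z''; split.
- apply: (Theta_concat pA (is_concat_cst A x) cz) => -[|k] //.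
- by apply: filterS2 hz hg => w [hw _] ->.
- by apply: filterS2 hz hg' => w [_ hw] ->.
Qed.

(** Countably many points exhaust every rational level set of the family up to null sets. An upward
    directed sequence dominating these points has a limit point in [Theta x], which then dominates
    every [z']. *)
Lemma Theta_maximizer x : exists2 z, Theta x z &
  forall z', Theta x z' -> le_as P (h (x, z')) (h (x, z)).
Proof.
have /choice[g gP] z : exists g : Omega -> \bar R,
    (forall q : rat, measurable [set w | ((ratr q)%:E < g w)%E]) /\
    \forall w \ae P, h (x, z) w = g w.
  have [g mg hg] := L0_under_version (h_under (x, z)); exists g; split=> // q.
  apply: GF; apply: measurable_gen => //.
  by rewrite -[X in measurable X]setTI; exact: emeasurable_fun_o_infty.
have /choice[c cP] q := countable_cover P (Theta_neq0 x)
  (fun z (_ : Theta x z) => (gP z).1 q).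
(* All the sequences [c q] in one enumeration; the value [c 0 0] fills in numbers that code no
   pair. *)
pose s m :=
  if @unpickle (rat * nat)%type m is Some (q, n) then c q n else c 0 0%N.
have Ts m : Theta x (s m).
  by rewrite /s; case: unpickle => [[q n]|]; exact: (cP _).1.
have /choice[j jP] (p : Z * Z) : exists z'', Theta x p.1 -> Theta x p.2 ->
    [/\ Theta x z'', le_as P (h (x, p.1)) (h (x, z'')) &
      le_as P (h (x, p.2)) (h (x, z''))].
  have [[T1 T2]|nT] := pselect (Theta x p.1 /\ Theta x p.2).
    by have [z'' ?] := Theta_directed T1 T2; exists z''.
  by exists p.1 => T1 T2; case: nT.
(* By the choice of [j], the values at [r n] increase with [n] and dominate the value at [s i] as
   soon as [n > i]. *)
pose r := fix r n := if n is m.+1 then j (r m, s m) else s 0%N.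
have Tr n : Theta x (r n).
  by elim: n => [|n IH] //=; have [] := jP (r n, s n) IH (Ts n).
have sr i k : le_as P (h (x, s i)) (h (x, r (i + k).+1)).
  elim: k => [|k IH]; first by rewrite addn0;
    have [] := jP (r i, s i) (Tr i) (Ts i).
  have [_ le1 _] := jP (r (i + k).+1, s (i + k).+1) (Tr _) (Ts _).
  by rewrite addnS; apply: filterS2 IH le1 => w; exact: le_trans.
have [z Tz hz] := Theta_limit (cvg_as_cst x) Tr.
have sz : \forall w \ae P, forall i, (h (x, s i) w <= h (x, z) w)%E.
  apply: filterS2 hz (ae_foralln (fun i => ae_foralln (sr i))) => w hzw srw i.
  apply: hzw; exists i.+1 => // -[//|n] /= ni.
  rewrite -(@subnKC i n ni); exact: srw.
exists z => // z' Tz'.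
have cov : \forall w \ae P, forall q : rat, ((ratr q)%:E < g z' w)%E ->
    exists n, ((ratr q)%:E < g (c q n) w)%E.
  apply/ae_forall_countable => q; have [_ /(_ _ Tz')] := cP q.
  apply: negligibleS => w /= /not_implyP[gw nw]; split=> // -[n _ /= hn].
  by apply: nw; exists n.
have gh : \forall w \ae P, forall i, h (x, s i) w = g (s i) w.
  by apply/ae_foralln => i; have [] := gP (s i).
apply: filterS3 (gP z').2 (ae_and sz gh) cov => w -> [szw ghw] covw.
apply/le_rat_lt => q /covw[n qn].
have sE : s (pickle (q, n)) = c q n by rewrite /s pickleK.
by apply: le_trans (szw (pickle (q, n))); rewrite ghw sE ltW.
Qed.

Variable y : X -> Omega -> \bar R.
Hypothesis y_attained : forall x,
  exists z, Theta x z /\ y x = h (x, z) %[ae P].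
Hypothesis y_ub : forall x z, Theta x z -> le_as P (h (x, z)) (y x).

(** Both inequalities on [A k] come from pasting: an optimal point over [x] decomposes into points
    over the [xs k], and optimal points over the [xs k] paste to a point over [x]. *)
Lemma value_stable : rv_stable P G DX y.
Proof.
move=> A xs x pA cx k; have [z [Tz /ae_eqP yz]] := y_attained x.
have := Tz; rewrite (Theta_stable pA cx) => -[zs Tzs cz].
have hz := h_stable pA (is_concat_pair cx cz) k.
have /choice[zs' zs'P] i := y_attained (xs i).
have [z' cz'] := concat_ex zs' pA.
have Tz' : Theta x z'.
  by apply: (Theta_concat pA cx cz') => i; have [] := zs'P i.
have hz' := h_stable pA (is_concat_pair cx cz') k.
have [Tk' /ae_eqP yk] := zs'P k.
apply: filterS3 (ae_and yz hz) (ae_and yk hz')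
  (ae_and (y_ub (Tzs k)) (y_ub Tz')) => w [yzw hzw] [ykw hzw'] [le1 le2] Akw.
apply/eqP; rewrite eq_le; apply/andP; split.
  by rewrite yzw hzw.
by rewrite ykw -[leLHS]hzw'.
Qed.

Lemma value_usc : rv_usc P DX y.
Proof.
move=> xs x cx.
have /choice[zs zsP] i := y_attained (xs i).
have /choice[g gP] n : exists g : Omega -> \bar R,
    (forall q : rat, G [set w | ((ratr q)%:E < g w)%E]) /\
    \forall w \ae P, h (xs n, zs n) w = g w.
  have [g mg hg] := L0_under_version (h_under (xs n, zs n)).
  exists g; split=> // q.
  apply: measurable_gen => //.
  by rewrite -[X in measurable X]setTI; exact: emeasurable_fun_o_infty.
have yg : \forall w \ae P, forall n, y (xs n) w = g n w.
  apply/ae_foralln => n; have [_ /ae_eqP yh] := zsP n.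
  by apply: filterS2 yh (gP n).2 => w -> ->.
suff H (q : rat) : \forall w \ae P,
    ((ratr q)%:E < limn_esup (g ^~ w))%E -> ((ratr q)%:E <= y x w)%E.
  apply: filterS2 yg (ae_forall_countable H) => w ygw Hw.
  by rewrite (_ : (fun n => _) = g ^~ w); [exact: le_rat_lt|exact/funext].
have first k := partition_first sG (fun n => (gP (k + n)%N).1 q).
have /choice[A AP] k : exists A, countable_partition G A /\
    (A 0%N = ~` (\bigcup_n [set w | ((ratr q)%:E < g (k + n)%N w)%E]) /\
     forall n, A n.+1 `<=` [set w | ((ratr q)%:E < g (k + n)%N w)%E]).
  by have [A pA ?] := first k; exists A.
have pA k := (AP k).1.
(* Block [n.+1] selects the pair of index [k + n], the first whose value exceeds [q]. On block 0,
   where there is none, the predecessor falls back to index [k], so all indices stay at least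
   [k]. *)
have /choice[xs1 cx1] k := concat_ex (fun i => xs (k + i.-1)%N) (pA k).
have /choice[zs1 cz1] k := concat_ex (fun i => zs (k + i.-1)%N) (pA k).
have Tz1 k : Theta (xs1 k) (zs1 k).
  by apply: Theta_concat (pA k) (cx1 k) (cz1 k) _ => i;
    have [] := zsP (k + i.-1)%N.
have AT k w : exists i, A k i w.
  have [_ _ U] := pA k; have : (\bigcup_i A k i) w by rewrite U.
  by case=> i _ ?; exists i.
have cx1x : cvg_as P DX xs1 x.
  have e := ae_foralln (fun k => ae_foralln (fun i => concat_dist (cx1 k) x i)).
  apply: filterS2 cx e => w cxw ew; apply: cvg_reindex cxw _ => k.
  by have [i Ai] := AT k w; exists (k + i.-1)%N; rewrite ?leq_addr ?(ew k i).
have [z Tz hz] := Theta_limit cx1x Tz1.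
have e := ae_foralln (fun k => ae_foralln
  (h_stable (pA k) (is_concat_pair (cx1 k) (cz1 k)))).
have hg := ae_foralln (fun n => (gP n).2).
apply: filterS3 (ae_and hz e) hg (y_ub Tz) => w [hzw ew] hgw le1 qw.
apply: le_trans le1; apply: hzw; apply: nearW => k.
(* Block 0 is impossible here: a limsup above [q] forces some index at least [k] with value above
   [q]. *)
have [[|i] Ai] := AT k w.
  have [n kn qn] := limn_esup_gt_frequently k qw.
  move: Ai; rewrite (AP k).2.1 => -[]; exists (n - k)%N => //=.
  by rewrite subnKC.
by rewrite (ew k _ Ai) /= hgw ltW//; exact: (AP k).2.2 Ai.
Qed.

End one_step.

(** * Backward induction for the control problem *)

Section control_problem.
Context {d : measure_display} {Omega : measurableType d} {R : realType}.
Context (P : probability Omega R) (T : nat) (F : nat -> set (set Omega)).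
Context (X Z : forall t, cond_metric_space P (F t)).
Context (Theta : forall t, X t -> set (Z t)).
Context (v : forall t, X t * Z t -> X t.+1).
Context (u : forall t, X t -> (Omega -> \bar R) -> Z t -> Omega -> \bar R).
Arguments u : clear implicits.
Context (uT : X T -> Omega -> \bar R).
Hypothesis filtF : is_filtration T F.
Hypothesis admTheta : forall t, (t < T)%N -> admissible_constraint (@Theta t).
Hypothesis admv : forall t, (t < T)%N -> admissible_transition (@v t).
Hypothesis admu : forall t, (t < T)%N -> admissible_generator (u t).
Hypothesis uT_under : forall x, L0_under P (F T) (uT x).

Lemma filtration_sigma t : (t <= T)%N -> sigma_algebra setT (F t).
Proof. by case: filtF => + _ _; exact. Qed.

(** Monotonicity in the second component, applied in both directions. *)
Lemma generator_ae t x f f' z : (t < T)%N ->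
  L0_under P (F t.+1) f -> L0_under P (F t.+1) f' -> f = f' %[ae P] ->
  u t x f z = u t x f' z %[ae P].
Proof.
move=> /admu[_ _ um _] Lf Lf' /ae_eqP ff'.
have le1 : le_as P (u t x f z) (u t x f' z).
  by apply: um => //; apply: filterS ff' => w ->.
have le2 : le_as P (u t x f' z) (u t x f z).
  by apply: um => //; apply: filterS ff' => w ->.
by apply/ae_eqP; apply: filterS2 le1 le2 => w h1 h2;
  apply/eqP; rewrite eq_le h1 h2.
Qed.

Section continuation.
Context (t : nat) (f : X t.+1 -> Omega -> \bar R).
Hypothesis tT : (t < T)%N.
Hypothesis f_under : forall x, L0_under P (F t.+1) (f x).
Hypothesis f_stable : rv_stable P (F t.+1) (cms_dist (X t.+1)) f.
Hypothesis f_usc : rv_usc P (cms_dist (X t.+1)) f.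
Let D := prod_dist (cms_dist (X t)) (cms_dist (Z t)).
Let h (p : X t * Z t) := u t p.1 (f (v p)) p.2.

Lemma continuation_under p : L0_under P (F t) (h p).
Proof. by have [uL _ _ _] := admu tT; exact: uL. Qed.

Lemma continuation_stable : rv_stable P (F t) D h.
Proof.
move=> A ps p pA cp; have [_ us _ _] := admu tT.
apply: us => //; apply: f_stable; last exact: (admv tT).1 cp.
by case: pA => FA tA UA; split=> // k; case: filtF => _ /(_ _ tT) + _; exact.
Qed.

(* Semicontinuity of [u t] in its second argument is only assumed along
   convergent sequences, so [f (v (ps n))] is replaced by its maximum with the
   limit value, which dominates it and converges. *)
Lemma continuation_usc : rv_usc P D h.
Proof.
move=> ps p cp; have [_ _ um uu] := admu tT.
have fp := f_usc ((admv tT).2 _ _ cp).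
pose g n w := maxe (f (v (ps n)) w) (f (v p) w).
have Lg n : L0_under P (F t.+1) (g n) by exact: L0_under_maxe.
have cg : rv_cvg P g (f (v p)).
  by apply: filterS fp => w; exact: cvg_maxe_limn_esup.
have le1 : \forall w \ae P, forall n,
    (h (ps n) w <= u t (ps n).1 (g n) (ps n).2 w)%E.
  apply/ae_foralln => n; apply: um => //.
  by apply: aeW => w; rewrite /g le_max lexx.
have := uu ps g p (f (v p)) Lg (f_under _) cp cg.
apply: filterS2 le1 => w le1; apply: le_trans.
apply/le_rat_lt => q; apply: contraTT; rewrite -!leNgt -ltNge.
move=> /limn_esup_lt uq; apply: limn_esup_le; apply: filterS uq => n /ltW.
exact/le_trans/le1.
Qed.

End continuation.

Lemma objectiveS t (p : (forall s, X s) * (forall s, Z s)) : (t < T)%N ->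
  objective u uT t p = u t (p.1 t) (objective u uT t.+1 p) (p.2 t).
Proof. by move=> tT; rewrite /objective /index_iota -(subnSK tT). Qed.

Lemma objectiveT (p : (forall s, X s) * (forall s, Z s)) :
  objective u uT T p = uT (p.1 T).
Proof. by rewrite /objective /index_iota subnn. Qed.

Lemma horizon_ind (Q : nat -> Prop) : Q T ->
  (forall t, (t < T)%N -> Q t.+1 -> Q t) -> forall t, (t <= T)%N -> Q t.
Proof.
move=> QT QS t tT; have : (t + (T - t) = T)%N by rewrite subnKC.
move: (T - t)%N => k {tT}; elim: k t => [|k IH] t; first by rewrite addn0 => ->.
move=> tk; apply: QS; first by rewrite -tk addnS ltnS leq_addr.
by apply: IH; rewrite addSnnS.
Qed.

Lemma filtration_measurable t : (t <= T)%N -> F t `<=` measurable.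
Proof.
case: filtF => _ FS FT; move: t; apply: horizon_ind; first by rewrite FT.
by move=> t tT; apply: subset_trans; exact: FS.
Qed.

Lemma objective_under t p : (t <= T)%N -> L0_under P (F t) (objective u uT t p).
Proof.
move: t; apply: horizon_ind; first by rewrite objectiveT.
by move=> t tT IH; rewrite objectiveS//; have [uL _ _ _] := admu tT; exact: uL.
Qed.

Lemma eq_objective t p p' : (t <= T)%N ->
  (forall s, (t <= s)%N -> p.1 s = p'.1 s) ->
  (forall s, (t <= s)%N -> p.2 s = p'.2 s) ->
  objective u uT t p = objective u uT t p'.
Proof.
move: t; apply: horizon_ind => [E1 _|t tT IH E1 E2].
  by rewrite !objectiveT E1.
by rewrite objectiveS// [RHS]objectiveS// E1// E2// IH// => s /ltnW;
  [exact: E1|exact: E2].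
Qed.

Lemma admissible_paths_tail t x p : (t < T)%N ->
  admissible_paths T Theta v x p ->
  Theta x (p.2 t) /\ admissible_paths T Theta v (v (x, p.2 t)) p.
Proof.
move=> tT [<- pP]; have [|p1 Tp] := pP t; first by rewrite leqnn.
split=> //.
by split=> // s /andP[ts sT]; apply: pP; rewrite (ltnW ts).
Qed.

(** Overwriting the time [t] components of a tail path affects neither its later transitions nor its
    objective from [t.+1] on. *)
Lemma admissible_paths_cons t x z p : (t < T)%N -> Theta x z ->
  admissible_paths T Theta v (v (x, z)) p ->
  let p' := (dfwith p.1 t x, dfwith p.2 t z) in
  admissible_paths T Theta v x p' /\
  objective u uT t p' = u t x (objective u uT t.+1 p) z.
Proof.
move=> tT Txz [p1 pP] p'.
have E1 s : (t < s)%N -> p'.1 s = p.1 s.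
  by move=> ts; rewrite /p'/= dfwithout// ltn_eqF.
have E2 s : (t < s)%N -> p'.2 s = p.2 s.
  by move=> ts; rewrite /p'/= dfwithout// ltn_eqF.
have e1 : p'.1 t = x by rewrite /p'/= dfwithin.
have e2 : p'.2 t = z by rewrite /p'/= dfwithin.
split; last by rewrite objectiveS// e1 e2 (eq_objective (p' := p)).
split=> // s /andP[]; rewrite leq_eqVlt => /predU1P[<- _|ts sT].
  by rewrite E1// e1 e2.
by rewrite !E1// ?E2//; [apply: pP; rewrite ts|exact: ltnW].
Qed.

Context (y : forall t, X t -> Omega -> \bar R).
Arguments y : clear implicits.
Hypothesis uT_stable : rv_stable P (F T) (cms_dist (X T)) uT.
Hypothesis uT_usc : rv_usc P (cms_dist (X T)) uT.
Hypothesis y_esup : forall t, (t < T)%N -> forall x : X t,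
  y t x = esup P (objective u uT t @` admissible_paths T Theta v x) %[ae P].
Hypothesis y_T : forall x, y T x = uT x %[ae P].

Let h t (x : X t) (z : Z t) := u t x (y t.+1 (v (x, z))) z.

(** The invariant of the backward induction. An attaining path together with a bound over all paths
    replaces the essential supremum, so that the horizon fits the same form and an optimal tail can
    be extended by one step. *)
Definition optimal_value t : Prop :=
  [/\ forall x, L0_under P (F t) (y t x),
      rv_stable P (F t) (cms_dist (X t)) (y t),
      rv_usc P (cms_dist (X t)) (y t),
      forall x, exists2 p, admissible_paths T Theta v x p &
        y t x = objective u uT t p %[ae P] &
      forall x p, admissible_paths T Theta v x p ->
        le_as P (objective u uT t p) (y t x)].

Lemma optimal_value_T : optimal_value T.
Proof.
split.
- by move=> x; exact: L0_ae (y_T x) (uT_under x).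
- move=> A xs x pA cx k.
  have := uT_stable pA cx k.
  apply: filterS3 (proj1 (ae_eqP _ _ _) (y_T x))
    (proj1 (ae_eqP _ _ _) (y_T (xs k))) => w -> -> //.
- move=> xs x cx; have := uT_usc cx.
  have := ae_foralln (fun n => proj1 (ae_eqP _ _ _) (y_T (xs n))).
  apply: filterS3 (proj1 (ae_eqP _ _ _) (y_T x)) => w -> Hn.
  rewrite (_ : (fun n => y T (xs n) w) = (fun n => uT (xs n) w))//.
  exact/funext.
- move=> x.
  (* Nonemptiness supplies arbitrary points at the other times; at the horizon there is no
     transition left to check. *)
  pose X0 s : X s := sval (cid (let: inhabits x := cms_nonempty (X s) in
    ex_intro (fun _ => True) x I)).
  pose Z0 s : Z s := sval (cid (let: inhabits x := cms_nonempty (Z s) in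
    ex_intro (fun _ => True) x I)).
  exists (dfwith X0 T x, Z0).
    by split=> [|s /andP[/leq_ltn_trans/[apply]]]; rewrite ?ltnn//= dfwithin.
  by rewrite objectiveT/= dfwithin.
- move=> x p [<- _]; rewrite objectiveT.
  by apply: filterS (proj1 (ae_eqP _ _ _) (y_T (p.1 T))) => w ->.
Qed.

(** Monotonicity of [u] bounds each path objective by [h] at its first control, and an optimal tail
    shows that each [h x z] is itself a path objective. Hence the supremum over paths is the
    one-step maximum. *)
Lemma optimal_value_step t : (t < T)%N -> optimal_value t.+1 ->
  (forall x, exists z, [/\ Theta x z, y t x = h x z %[ae P] &
     forall z', Theta x z' -> le_as P (h x z') (h x z)]) /\
  optimal_value t.
Proof.
move=> tT [yL yS yU y_ex y_le]; have tT' := ltnW tT.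
have sF := filtration_sigma tT'; have mF := filtration_measurable tT'.
have [T0 TS TC TU] := admTheta tT.
have hL := continuation_under tT yL.
have hS := continuation_stable tT yL yS.
have hU := continuation_usc tT yL yU.
have hmax := Theta_maximizer sF mF T0 TS TC TU hL hS hU.
have obj_le (x : X t) p : admissible_paths T Theta v x p ->
    le_as P (objective u uT t p) (h x (p.2 t)).
  move=> px; have [Tp pp] := admissible_paths_tail tT px.
  have [_ _ um _] := admu tT; rewrite objectiveS// (proj1 px).
  by apply: um => //; [exact: objective_under|exact: y_le].
have opt (x : X t) (z : Z t) : Theta x z ->
    exists2 p, admissible_paths T Theta v x p &
    h x z = objective u uT t p %[ae P].
  move=> Txz; have [p pp yp] := y_ex (v (x, z)).
  have [p'p op'] := admissible_paths_cons tT Txz pp.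
  eexists; first exact: p'p.
  by rewrite op'; apply: generator_ae => //; exact: objective_under.
have L0bar G f : G `<=` measurable -> L0_under P G f -> L0_bar P measurable f.
  by move=> mG; exact: L0_sub.
(* A maximizer [z] of [h x] yields a path with objective [h x z] that beats every other path, so the
   essential supremum defining [y t x] is attained there. *)
have yh (x : X t) (z : Z t) : Theta x z ->
    (forall z', Theta x z' -> le_as P (h x z') (h x z)) ->
    y t x = h x z %[ae P].
  move=> Txz hz; have [p px hp] := opt x z Txz.
  apply: ae_eq_trans (y_esup tT x) _; apply: ae_eq_trans (ae_eq_sym hp).
  apply: esup_attained => // [p' _|p' p'x].
    by apply: L0bar mF _; exact: objective_under.
  have [Tp' _] := admissible_paths_tail tT p'x.
  apply: filterS3 (obj_le _ _ p'x) (hz _ Tp') (proj1 (ae_eqP _ _ _) hp).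
  by move=> w le1 le2 <-; exact: le_trans le1 le2.
have yz (x : X t) : exists z, [/\ Theta x z, y t x = h x z %[ae P] &
     forall z', Theta x z' -> le_as P (h x z') (h x z)].
  by have [z Tz hz] := hmax x; exists z; split => //; exact: yh.
have y_at (x : X t) : exists z, Theta x z /\ y t x = h x z %[ae P].
  by have [z [Tz e _]] := yz x; exists z.
have y_ub (x : X t) (z : Z t) : Theta x z -> le_as P (h x z) (y t x).
  move=> Tz; have [z' [_ /ae_eqP e hz']] := yz x.
  by apply: filterS2 e (hz' _ Tz) => w ->.
split=> //; split.
- by move=> x; have [z [_ e _]] := yz x; apply: L0_ae e _; exact: (hL (x, z)).
- exact: (value_stable TS hS y_at y_ub).
- exact: (value_usc sF TS TC TU hL hS hU y_at y_ub).
- move=> x; have [z [Tz e _]] := yz x; have [p px hp] := opt x z Tz.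
  by exists p => //; exact: ae_eq_trans hp.
- move=> x p px; have [Tp _] := admissible_paths_tail tT px.
  by apply: filterS2 (obj_le _ _ px) (y_ub _ _ Tp) => w; exact: le_trans.
Qed.

Lemma optimal_valueP t : (t <= T)%N -> optimal_value t.
Proof.
move: t; apply: horizon_ind; first exact: optimal_value_T.
by move=> t tT /(optimal_value_step tT)[].
Qed.

Lemma value_is_max t (x : X t) : (t < T)%N ->
  is_max P (Theta x) (h x) (y t x).
Proof.
move=> tT; have yL1 := optimal_valueP tT.
have [/(_ x)[z [Tz yz hz]] _] := optimal_value_step tT yL1.
have e : esup P (h x @` Theta x) = h x z %[ae P].
  apply: esup_attained => // z' Tz'; have [yL _ _ _ _] := yL1.
  have := continuation_under tT yL (x, z').
  by apply: L0_sub => //; exact: filtration_measurable (ltnW tT).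
split; first exact: ae_eq_trans yz (ae_eq_sym e).
by exists z; split=> //; exact: ae_eq_sym.
Qed.

(** Backward along the path, the argmax condition replaces [y t] by [h] at the chosen control, and
    the induction hypothesis replaces [y t.+1] inside [u] by the tail objective. *)
Lemma argmax_path_value t (xs : forall s, X s) (zs : forall s, Z s) :
  (t <= T)%N ->
  (forall s, (t <= s < T)%N -> xs s.+1 = v (xs s, zs s) /\
     argmax P (Theta (xs s)) (h (xs s)) (zs s)) ->
  y t (xs t) = objective u uT t (xs, zs) %[ae P].
Proof.
move: t; apply: horizon_ind => [_|t tT IH opt]; first by rewrite objectiveT.
have [|xE [Tz hz]] := opt t; first by rewrite leqnn.
have [ye _] := value_is_max (xs t) tT.
apply: ae_eq_trans ye _; apply: ae_eq_trans (ae_eq_sym hz) _.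
rewrite objectiveS//= /h -xE; have [yL _ _ _ _] := optimal_valueP tT.
apply: generator_ae => //; first exact: objective_under.
by apply: IH => s /andP[ts sT]; apply: opt; rewrite (ltnW ts).
Qed.

End control_problem.

Theorem theorem2p5 (d : measure_display) (Omega : measurableType d)
    (R : realType) (P : probability Omega R) (T : nat)
    (F : nat -> set (set Omega))
    (X Z : forall t, cond_metric_space P (F t))
    (Theta : forall t, X t -> set (Z t))
    (v : forall t, X t * Z t -> X t.+1)
    (u : forall t, X t -> (Omega -> \bar R) -> Z t -> Omega -> \bar R)
    (uT : X T -> Omega -> \bar R)
    (y : forall t, X t -> Omega -> \bar R) :
  (0 < T)%N ->
  is_filtration T F ->
  (forall t, (t < T)%N -> admissible_constraint (@Theta t)) ->
  (forall t, (t < T)%N -> admissible_transition (@v t)) ->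
  (forall t, (t < T)%N -> admissible_generator (@u t)) ->
  (forall x, L0_under P (F T) (uT x)) ->
  rv_stable P (F T) (cms_dist (X T)) uT ->
  rv_usc P (cms_dist (X T)) uT ->
  (forall t, (t < T)%N -> forall x : X t,
     y t x = esup P (objective u uT t @` admissible_paths T Theta v x)
       %[ae P]) ->
  (forall x, y T x = uT x %[ae P]) ->
  let h t (x : X t) (z : Z t) := u t x (y t.+1 (v t (x, z))) z in
  [/\ forall t, (t <= T)%N ->
        [/\ forall x, L0_under P (F t) (y t x),
            rv_stable P (F t) (cms_dist (X t)) (y t) &
            rv_usc P (cms_dist (X t)) (y t)],
      forall x, y T x = uT x %[ae P],
      forall t, (t < T)%N -> forall x : X t,
        is_max P (Theta t x) (h t x) (y t x) &
      forall t, (t < T)%N -> forall (xt : X t)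
        (xs : forall s, X s) (zs : forall s, Z s),
        xs t = xt ->
        (forall s, (t <= s < T)%N ->
           xs s.+1 = v s (xs s, zs s) /\
           argmax P (Theta s (xs s)) (h s (xs s)) (zs s)) ->
        admissible_paths T Theta v xt (xs, zs) /\
        y t xt = objective u uT t (xs, zs) %[ae P]].
Proof.
move=> _ filtF admTheta admv admu uT_under uT_stable uT_usc y_esup y_T h.
have yP t : (t <= T)%N -> optimal_value Theta v u uT y t.
  exact: optimal_valueP.
split=> //.
- by move=> t /yP[].
- move=> t tT x.
  exact: (value_is_max filtF admTheta admv admu uT_under uT_stable uT_usc).
- move=> t tT xt xs zs <- opt; split.
    by split=> // s /opt[xE []].
  exact: (argmax_path_value filtF admTheta admv admu uT_under uT_stable uT_usc
    y_esup y_T (ltnW tT)).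
Qed.
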